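(* Let $(M,\varphi,\xi,\eta,g)$ be an almost contact pseudo-metric manifold whose corresponding almost $CR$ structure $(\mathcal{H}(M),J,\theta)$, given by $\mathcal{H}(M)=\mathrm{Ker}\,\eta$, $J=\varphi|_{\mathcal{H}(M)}$, $\theta=-\eta$, is nondegenerate. Then $(M,\mathcal{H}(M),J)$ is a $CR$ manifold (i.e. the almost $CR$ structure is integrable) if and only if $$(\nabla_XJ)Y-(\nabla_{JX}J)JY=\alpha(X,Y)\,\xi$$ for all $X,Y\in\mathcal{H}(M)$, where $\alpha(X,Y)=(\nabla_X\theta)(JY)+(\nabla_{JX}\theta)(Y)$.
   Context: An almost contact pseudo-metric manifold $(M,\varphi,\xi,\eta,g)$ is a smooth connected manifold $M$ of dimension $2n+1$ with a $(1,1)$ tensor field $\varphi$, a vector field $\xi$, a $1$-form $\eta$ and a pseudo-Riemannian metric $g$ such that $\varphi^2=-I+\eta\otimes\xi$, $\eta(\xi)=1$, $\varphi\xi=0$, $\eta\circ\varphi=0$, and $g(\varphi X,\varphi Y)=g(X,Y)-\varepsilon\eta(X)\eta(Y)$ for all $X,Y$, where $\varepsilon=\pm1$ is a fixed sign; this condition is equivalent to $\eta(X)=\varepsilon g(X,\xi)$ together with $g(\varphi X,Y)=-g(X,\varphi Y)$, and so $g(\xi,\xi)=\varepsilon$. $\nabla$ is the Levi-Civita connection of $g$. For $X,Y$ sections of $\mathcal{H}(M)$, $(\nabla_XJ)Y$ means $(\nabla_X\varphi)Y=\nabla_X(\varphi Y)-\varphi(\nabla_XY)$, i.e. $J$ is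 extended to $TM$ by $J\xi=0$. An almost $CR$ structure on a $(2n+1)$-dimensional manifold $M$ is a pair $(\mathcal{H}(M),J)$, where $\mathcal{H}(M)$ is a smooth real subbundle of rank $2n$ of $TM$ and $J:\mathcal{H}(M)\to\mathcal{H}(M)$ is a smooth bundle isomorphism with $J^2=-I$. It is integrable (and is then called a $CR$ structure, and $M$ a $CR$ manifold) if for all sections $X,Y$ of $\mathcal{H}(M)$: $[JX,Y]+[X,JY]\in\mathcal{H}(M)$ and $J([JX,Y]+[X,JY])=[JX,JY]-[X,Y]$. Given a $1$-form $\theta$ with $\mathrm{Ker}\,\theta=\mathcal{H}(M)$, the Levi form is $L_\theta(X,Y)=d\theta(X,JY)$ for $X,Y\in\mathcal{H}(M)$, with $d\theta(X,Y)=\frac12\big(X\theta(Y)-Y\theta(X)-\theta([X,Y])\big)$. The structure $(\mathcal{H}(M),J,\theta)$ is nondegenerate if $L_\theta$ is a nondegenerate Hermitian form (Hermitian meaning $L_\theta(JX,JY)=L_\theta(X,Y)$). *)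

(* Defs.v *)
From HB Require Import structures.
From mathcomp Require Import all_boot all_order all_algebra.
From mathcomp Require Import ring.
From mathcomp Require Import boolp classical_sets functions reals.
From mathcomp Require Import topology normedtype derive.
Set Implicit Arguments.
Unset Strict Implicit.
Unset Printing Implicit Defensive.
Import Order.TTheory GRing.Theory Num.Theory numFieldNormedType.Exports.
Local Open Scope classical_set_scope.
Local Open Scope ring_scope.

Section Ck.
Variables (R : realType) (m : nat).
Implicit Types (V : set 'rV[R]_m) (f g : 'rV[R]_m -> R).

Definition basis_vec (i : 'I_m) : 'rV[R]_m := delta_mx 0 i.

(* All iterated partial derivatives of order at most k exist and are
   continuous on V; only meant for open V. *)
Fixpoint Ck (k : nat) V f : Prop :=
  {in V, continuous f} /\
  if k is k'.+1 then
    forall i : 'I_m, (forall x, V x -> derivable f x (basis_vec i)) /\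
                     Ck k' V ('D_(basis_vec i) f)
  else True.

Definition Cinf V f := forall k, Ck k V f.

Lemma CkS k V f : Ck k.+1 V f -> Ck k V f.
Proof.
elim: k f => [|k IH] f [cf df]; first by split.
by split => // i; have [di Di] := df i; split => //; exact: IH.
Qed.

Lemma Ck_ext k V f g : open V -> (forall x, V x -> f x = g x) ->
  Ck k V f -> Ck k V g.
Proof.
move=> oV; elim: k f g => [|k IH] f g fg.
all: have nfg x : V x -> {near x, f =1 g}
  by move=> Vx; apply: (filterS fg); exact: open_nbhs_nbhs (conj oV Vx).
all: have cvg_g : {in V, continuous f} -> {in V, continuous g}
  by move=> cf x xV; have Vx := set_mem xV; rewrite /continuous_at -(fg _ Vx);
     apply: cvg_trans (cf x xV); exact: near_eq_cvg (nfg x Vx).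
  by move=> [cf _]; split => //; exact: cvg_g.
move=> [cf df]; split => [|i]; first exact: cvg_g.
have [di Di] := df i; split => [x Vx|].
  exact: near_eq_derivable (nfg x Vx) (di x Vx).
by apply: IH Di => x Vx; apply: near_eq_derive; exact: nfg.
Qed.

Lemma Ck_cst k V (c : R) : Ck k V (cst c).
Proof.
elim: k c => [|k IH] c; first by split => // x _; exact: cst_continuous.
split => [x _|i]; first exact: cst_continuous.
split=> [x _|]; first exact: derivable_cst.
rewrite (_ : 'D_ _ _ = cst 0); first exact: IH.
by apply/funext => x; rewrite derive_cst.
Qed.

Lemma CkD k V f g : open V -> Ck k V f -> Ck k V g -> Ck k V (f + g).
Proof.
move=> oV; elim: k f g => [|k IH] f g [cf df] [cg dg].
all: split => [x xV|//]; try by apply: continuousD; [exact: cf|exact: cg].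
move=> i; have [di Di] := df i; have [ei Ei] := dg i; split => [x Vx|].
  by apply: derivableD; [exact: di|exact: ei].
apply: (Ck_ext oV) (IH _ _ Di Ei) => x Vx.
by rewrite deriveD//; [exact: di|exact: ei].
Qed.

Lemma CkM k V f g : open V -> Ck k V f -> Ck k V g -> Ck k V (f * g).
Proof.
move=> oV; elim: k f g => [|k IH] f g Cf Cg.
all: have [cf df] := Cf; have [cg dg] := Cg.
all: split => [x xV|//]; try by apply: continuousM; [exact: cf|exact: cg].
move=> i; have [di Di] := df i; have [ei Ei] := dg i; split => [x Vx|].
  by apply: derivableM; [exact: di|exact: ei].
have := CkD oV (IH _ _ (CkS Cf) Ei) (IH _ _ (CkS Cg) Di).
by apply: Ck_ext => // x Vx; rewrite deriveM//; [exact: di|exact: ei].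
Qed.

End Ck.

Section Manifold.
Variables (R : realType) (m : nat).

Record chart (M : topologicalType) := Chart {
  chart_dom : set M ;
  chart_cod : set 'rV[R]_m ;
  chart_map : M -> 'rV[R]_m ;
  chart_inv : 'rV[R]_m -> M ;
  chart_dom_open : open chart_dom ;
  chart_cod_open : open chart_cod ;
  chart_mapP : forall p, chart_dom p -> chart_cod (chart_map p) ;
  chart_invP : forall x, chart_cod x -> chart_dom (chart_inv x) ;
  chart_mapK : {in chart_dom, cancel chart_map chart_inv} ;
  chart_invK : {in chart_cod, cancel chart_inv chart_map} ;
  chart_map_cont : {in chart_dom, continuous chart_map} ;
  chart_inv_cont : {in chart_cod, continuous chart_inv} }.

(* The atlas need not be maximal: it determines the smooth structure. *)
Record manifold := Manifold {
  manifold_top :> topologicalType ;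
  manifold_hausdorff : hausdorff_space manifold_top ;
  manifold_countable : @second_countable manifold_top ;
  atlas : set (chart manifold_top) ;
  atlas_cover : forall p, exists2 c, atlas c & chart_dom c p ;
  atlas_compat : forall c d, atlas c -> atlas d -> forall j : 'I_m,
    Cinf (chart_cod c `&` chart_inv c @^-1` chart_dom d)
         (fun x => chart_map d (chart_inv c x) 0 j) }.

Definition smooth (M : manifold) (f : M -> R) :=
  forall c, atlas c -> Cinf (chart_cod c) (f \o chart_inv c).

End Manifold.

Section SmoothFunctions.
Variables (R : realType) (m : nat) (M : manifold R m).

Definition smooth_pred : {pred M -> R} := fun f => `[< smooth f >].

Record smoothfun := SmoothFun {
  smoothfun_val :> M -> R ;
  smoothfun_mem : smoothfun_val \in smooth_pred }.

HB.instance Definition _ := [isSub for smoothfun_val].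
HB.instance Definition _ := [Choice of smoothfun by <:].

Lemma smooth_subring : subring_closed smooth_pred.
Proof.
have oC (c : chart R m M) := @chart_cod_open _ _ _ c.
split => [|f g|f g].
- by apply/asboolP => c _ k; exact: Ck_cst.
- move=> /asboolP sf /asboolP sg; apply/asboolP => c cA k.
  rewrite (_ : _ \o _ = (f \o chart_inv c) +
     cst (-1) * (g \o chart_inv c)); last first.
    by apply/funext => x /=; rewrite !fctE /= mulN1r.
  apply: CkD => //; first exact: sf.
  by apply: CkM => //; [exact: Ck_cst | exact: sg].
- move=> /asboolP sf /asboolP sg; apply/asboolP => c cA k.
  by apply: (@CkM _ _ _ _ (f \o _) (g \o _)) => //; [exact: sf | exact: sg].
Qed.

HB.instance Definition _ :=
  GRing.isSubringClosed.Build _ smooth_pred smooth_subring.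
HB.instance Definition _ := 
  GRing.SubChoice_isSubComPzRing.Build _ _ smoothfun (subringClosedP _).

Lemma smooth_scaler : scaler_closed smooth_pred.
Proof.
move=> a f /asboolP sf; apply/asboolP => c cA k.
apply: (@CkM _ _ _ _ (cst a) (f \o _)); first exact: chart_cod_open.
  exact: Ck_cst.
exact: sf.
Qed.
HB.instance Definition _ :=
  GRing.isScaleClosed.Build _ _ smooth_pred smooth_scaler.
HB.instance Definition _ := [SubZmodule_isSubLmodule of smoothfun by <:].

End SmoothFunctions.

Section Tangent.
Variables (R : realType) (m : nat) (M : manifold R m).
Implicit Types (p : M) (f g : smoothfun M).

(* T_pM is the space of derivations of C^oo(M) at p. *)
Definition tangent_pred p : {pred smoothfun M -> R} := fun v =>
  `[< (forall a f g, v (a *: f + g) = a * v f + v g) /\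
      (forall f g, v (f * g) = f p * v g + g p * v f) >].

Record tangent p := Tangent {
  tangent_val :> smoothfun M -> R ;
  tangent_mem : tangent_val \in tangent_pred p }.

HB.instance Definition _ p := [isSub for @tangent_val p].
HB.instance Definition _ p := [Choice of tangent p by <:].

Lemma tangent_submod p : submod_closed (tangent_pred p).
Proof.
split=> [|a u v /asboolP[u1 u2] /asboolP[v1 v2]]; apply/asboolP; split=> *.
- by rewrite /= mulr0 addr0.
- by rewrite /= !mulr0 addr0.
- by rewrite !fctE u1 v1 /GRing.scale /=; ring.
- by rewrite !fctE u2 v2 /GRing.scale /=; ring.
Qed.

HB.instance Definition _ p :=
  GRing.isSubmodClosed.Build _ _ (tangent_pred p) (tangent_submod p).
HB.instance Definition _ p := [SubChoice_isSubLmodule of tangent p by <:].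

End Tangent.

Section VectorFields.
Variables (R : realType) (m : nat) (M : manifold R m).
Implicit Types (f g : smoothfun M).

(* X is smooth iff X f is a smooth function for every f in C^oo(M). *)
Record vfield := VField {
  vfield_val :> forall p : M, tangent p ;
  vfield_smooth : forall f, smooth (fun p => vfield_val p f) }.

Lemma smoothfunP f : smooth f.
Proof. by case: f => f /= /asboolP. Qed.

Definition mk_smooth (h : M -> R) (sh : smooth h) : smoothfun M :=
  SmoothFun (asboolT sh).

(* the function X f *)
Definition der (X : vfield) f : smoothfun M := mk_smooth (vfield_smooth X f).

Lemma smoothfun_ext f g : (forall p, f p = g p) -> f = g.
Proof. by move=> fg; apply/val_inj/funext. Qed.

Lemma vfield_ext (X Y : vfield) : (forall p, X p = Y p) -> X = Y.
Proof.
case: X Y => [X sX] [Y sY] /= XY; have {}XY := functional_extensionality_dep XY.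
by subst Y; congr VField; exact: Prop_irrelevance.
Qed.

HB.instance Definition _ := gen_eqMixin vfield.
HB.instance Definition _ := gen_choiceMixin vfield.

Lemma vzero_smooth f : smooth (fun p => (0 : tangent p) f).
Proof. exact: (smoothfunP 0). Qed.
Definition vzero := VField vzero_smooth.

Lemma vadd_smooth (X Y : vfield) f : smooth (fun p => (X p + Y p) f).
Proof. exact: (smoothfunP (der X f + der Y f)). Qed.
Definition vadd X Y := VField (vadd_smooth X Y).

Lemma vopp_smooth (X : vfield) f : smooth (fun p => (- X p) f).
Proof. exact: (smoothfunP (- der X f)). Qed.
Definition vopp X := VField (vopp_smooth X).

Lemma vscale_smooth f (X : vfield) g : smooth (fun p => (f p *: X p) g).
Proof. exact: (smoothfunP (f * der X g)). Qed.
Definition vscale f X := VField (vscale_smooth f X).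

Lemma vaddA : associative vadd.
Proof. by move=> X Y Z; apply: vfield_ext => p; exact: addrA. Qed.
Lemma vaddC : commutative vadd.
Proof. by move=> X Y; apply: vfield_ext => p; exact: addrC. Qed.
Lemma vadd0 : left_id vzero vadd.
Proof. by move=> X; apply: vfield_ext => p; exact: add0r. Qed.
Lemma vaddN : left_inverse vzero vopp vadd.
Proof. by move=> X; apply: vfield_ext => p; exact: addNr. Qed.
HB.instance Definition _ :=
  GRing.isZmodule.Build vfield vaddA vaddC vadd0 vaddN.

Lemma vscaleA f g X : vscale f (vscale g X) = vscale (f * g) X.
Proof. by apply: vfield_ext => p; exact: scalerA. Qed.
Lemma vscale1 : left_id 1 vscale.
Proof. by move=> X; apply: vfield_ext => p; exact: scale1r. Qed.
Lemma vscaleDr : right_distributive vscale +%R.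
Proof. by move=> f X Y; apply: vfield_ext => p; exact: scalerDr. Qed.
Lemma vscaleDl X : {morph vscale^~ X : f g / f + g}.
Proof. by move=> f g; apply: vfield_ext => p; exact: scalerDl. Qed.
HB.instance Definition _ :=
  GRing.Zmodule_isLmodule.Build (smoothfun M) vfield
    vscaleA vscale1 vscaleDr vscaleDl.

Lemma lie_tangent (X Y : vfield) p :
  (fun f => X p (der Y f) - Y p (der X f)) \in tangent_pred p.
Proof.
have lin (Z W : vfield) q a f g :
    Z q (der W (a *: f + g)) = a * Z q (der W f) + Z q (der W g).
  have [Zl _] := asboolP _ (tangent_mem (Z q)).
  rewrite -Zl; congr (Z q _); apply: smoothfun_ext => r.
  by have [Wl _] := asboolP _ (tangent_mem (W r)); exact: Wl.
have lbz (Z W : vfield) q f g : Z q (der W (f * g)) =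
    f q * Z q (der W g) + W q g * Z q f + (g q * Z q (der W f) + W q f * Z q g).
  have [Zl Zm] := asboolP _ (tangent_mem (Z q)).
  have -> : der W (f * g) = 1 *: (f * der W g) + g * der W f.
    apply: smoothfun_ext => r.
    have [_ Wm] := asboolP _ (tangent_mem (W r)).
    by rewrite scale1r; exact: Wm.
  by rewrite Zl !Zm mul1r.
by apply/asboolP; split=> [a f g|f g]; rewrite ?lin ?lbz; ring.
Qed.

Lemma lie_smooth (X Y : vfield) f :
  smooth (fun p => Tangent (lie_tangent X Y p) f).
Proof. exact: (smoothfunP (der X (der Y f) - der Y (der X f))). Qed.

(* [X, Y] f = X (Y f) - Y (X f) *)
Definition lie X Y : vfield := VField (lie_smooth X Y).

End VectorFields.

(* Tensor fields are C^oo(M)-multilinear maps on vector fields. *)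
Notation endo M := {linear vfield M -> vfield M}.
Notation form1 M := {scalar vfield M}.

Section Tensors.
Variables (R : realType) (m : nat) (M : manifold R m).
Implicit Types (f : smoothfun M) (X Y Z : vfield M) (J : endo M)
  (theta : form1 M).

(* exterior derivative, with the factor 1/2 *)
Definition dform theta X Y : smoothfun M :=
  2^-1 *: (der X (theta Y) - der Y (theta X) - theta (lie X Y)).

(* metric_nondeg says that the bilinear form g_p on T_pM, which is given by
   g_p (X p) (Y p) = g X Y p, is nondegenerate at every point p.  The index of
   g is locally constant, hence constant when M is connected. *)
Record pseudo_metric := PseudoMetric {
  metric_val :> vfield M -> {scalar vfield M} ;
  metric_sym : forall X Y, metric_val X Y = metric_val Y X ;
  metric_nondeg : forall X (p : M),
    (forall Y, metric_val X Y p = 0) -> X p = 0 }.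

Record connection := Connection {
  nabla :> vfield M -> vfield M -> vfield M ;
  nabla_lin : forall f X X' Y,
    nabla (f *: X + X') Y = f *: nabla X Y + nabla X' Y ;
  nabla_add : forall X Y Y', nabla X (Y + Y') = nabla X Y + nabla X Y' ;
  nabla_leibniz : forall X f Y,
    nabla X (f *: Y) = der X f *: Y + f *: nabla X Y }.

Definition levi_civita (g : pseudo_metric) (D : connection) :=
  (forall X Y, D X Y - D Y X = lie X Y) /\
  (forall X Y Z, der X (g Y Z) = g (D X Y) Z + g Y (D X Z)).

(* (nabla_X J) Y *)
Definition cov_endo (D : connection) X J Y : vfield M := D X (J Y) - J (D X Y).

(* (nabla_X theta) Y *)
Definition cov_form (D : connection) X theta Y : smoothfun M :=
  der X (theta Y) - theta (D X Y).

End Tensors.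

Section CR.
Variables (R : realType) (m : nat) (M : manifold R m).
(* A subbundle H of TM is given by the set of its smooth sections, and its
   endomorphism J by an extension of J to TM: only the values of J on sections
   of H are used. *)
Implicit Types (H : set (vfield M)) (J : endo M) (theta : form1 M)
  (X Y : vfield M).

Definition ker_form theta : set (vfield M) := [set X | theta X = 0].

Definition CR_integrable H J := forall X Y, H X -> H Y ->
  H (lie (J X) Y + lie X (J Y)) /\
  J (lie (J X) Y + lie X (J Y)) = lie (J X) (J Y) - lie X Y.

Definition levi_form J theta X Y : smoothfun M := dform theta X (J Y).

Definition levi_hermitian H J theta := forall X Y, H X -> H Y ->
  levi_form J theta (J X) (J Y) = levi_form J theta X Y.

(* pointwise nondegeneracy on the fibre H_p, for every p *)
Definition levi_nondegenerate H J theta := forall X (p : M), H X ->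
  (forall Y, H Y -> levi_form J theta X Y p = 0) -> X p = 0.

Definition CR_nondegenerate H J theta :=
  levi_hermitian H J theta /\ levi_nondegenerate H J theta.

Record almost_contact_pseudo_metric := AlmostContact {
  phi : endo M ;
  xi : vfield M ;
  eta : form1 M ;
  metric : pseudo_metric M ;
  eps : R ;
  epsP : eps = 1 \/ eps = -1 ;
  phi_sq : forall X, phi (phi X) = - X + eta X *: xi ;
  eta_xi : eta xi = 1 ;
  phi_xi : phi xi = 0 ;
  eta_phi : forall X, eta (phi X) = 0 ;
  metric_phi : forall X Y,
    metric (phi X) (phi Y) = metric X Y - eps *: (eta X * eta Y) }.

End CR.

Arguments almost_contact_pseudo_metric {R m} M.

(* Main.v *)
Require Import Defs.
From mathcomp Require Import all_boot all_order all_algebra ring lra.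
From mathcomp Require Import boolp classical_sets functions reals.
From mathcomp Require Import topology normedtype derive.
Import GRing.Theory Num.Theory numFieldNormedType.Exports.
Local Open Scope classical_set_scope.
Local Open Scope ring_scope.

(** Write [J] for [phi], and let [Q X Y] ([commutator] below) be the difference
    [(nabla_X J) Y - (nabla_(J X) J) (J Y)] on the left of the criterion.  Both
    sides of the equivalence are governed by one expression ([twist] below),

      [T X Y = J ((nabla_X J) Y) - (nabla_(J X) J) Y],

    taken modulo [xi], that is, after applying [J], whose kernel is spanned
    by [xi].

    On the one hand, [J (Q X Y) = T X Y] modulo [xi] because [J] anticommutes
    with [nabla_Z J] modulo [xi] on horizontal fields (lemmas [cov_phi_phi] and
    [phi_commutator]); as [alpha X Y] is exactly [eta (Q X Y)], the criterion
    says that [T] vanishes modulo [xi].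
    On the other hand, since [nabla] is torsion free, the Nijenhuis-type tensor

      [J ([J X, Y] + [X, J Y]) - ([J X, J Y] - [X, Y])]

    equals [T X Y - T Y X] modulo [xi] (lemma [nijenhuis_twist]).  Hermitian
    symmetry of the Levi form says that [[J X, Y] + [X, J Y]] is horizontal,
    which also kills the [xi]-component of that tensor, so integrability
    says that [T] is symmetric modulo [xi].

    So the criterion trivially implies integrability.  For the converse, [J]
    and hence [nabla_Z J] are skew for the metric, from which
    [(X, Y, Z) |-> g (T X Y, Z)] is skew in [Y, Z] on horizontal fields
    (lemma [metric_twist_skew]).  A trilinear form that is symmetric in its
    first two arguments and skew in its last two vanishes, as for the difference
    of two metric torsion-free connections (lemma [sym_skew_eq0]). *)

(** * Vector fields as derivations *)

Section VectorFields.
Context {R : realType} {m : nat} {M : manifold R m}.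
Implicit Types (X Y : vfield M) (f h : smoothfun M).

Lemma vfield_der_inj X Y : (forall h, der X h = der Y h) -> X = Y.
Proof.
move=> XY; apply: vfield_ext => p; apply/val_inj/funext => h.
exact: (congr1 (fun k : smoothfun M => k p) (XY h)).
Qed.

Lemma derD X Y h : der (X + Y) h = der X h + der Y h.
Proof. exact: smoothfun_ext. Qed.

Lemma derN X h : der (- X) h = - der X h.
Proof. exact: smoothfun_ext. Qed.

Lemma derZ f X h : der (f *: X) h = f * der X h.
Proof. exact: smoothfun_ext. Qed.

Lemma der0r X : der X 0 = 0.
Proof.
apply: smoothfun_ext => p; have [Xlin _] := asboolP _ (tangent_mem (X p)).
by have := Xlin (-1) 0 0; rewrite scaler0 addr0 mulN1r addNr.
Qed.

Lemma derNr X f : der X (- f) = - der X f.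
Proof.
apply: smoothfun_ext => p; have [Xlin _] := asboolP _ (tangent_mem (X p)).
have X0 : X p 0 = 0 := congr1 (fun k : smoothfun M => k p) (der0r X).
by have := Xlin (-1) f 0; rewrite scaleN1r addr0 X0 addr0 mulN1r.
Qed.

Lemma smoothfun_addrr_eq0 f : f + f = 0 -> f = 0.
Proof.
move=> ff; apply: smoothfun_ext => p.
have : f p + f p = 0 := congr1 (fun k : smoothfun M => k p) ff.
by rewrite (_ : (0 : smoothfun M) p = 0)//; lra.
Qed.

Lemma lieNr X Y : lie X (- Y) = - lie X Y.
Proof.
apply: vfield_der_inj => h; rewrite derN.
have lieE Z W : der (lie Z W) h = der Z (der W h) - der W (der Z h).
  exact: smoothfun_ext.
by rewrite !lieE !derN derNr; ring.
Qed.

Lemma nablaNr (D : connection M) X Y : D X (- Y) = - D X Y.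
Proof.
have D0 : D X 0 = 0 by apply: (addrI (D X 0)); rewrite -nabla_add !addr0.
by apply: (addrI (D X Y)); rewrite -nabla_add !subrr.
Qed.

Lemma metricBl (g : pseudo_metric M) X Y Z : g (X - Y) Z = g X Z - g Y Z.
Proof. by rewrite Defs.metric_sym linearB /= !(Defs.metric_sym _ Z). Qed.

Lemma sym_skew_eq0 {V : Type} (P : V -> Prop) (t : V -> V -> V -> smoothfun M) :
  (forall u v w, P u -> P v -> P w -> t u v w = t v u w) ->
  (forall u v w, P u -> P v -> P w -> t u v w = - t u w v) ->
  forall u v w, P u -> P v -> P w -> t u v w = 0.
Proof.
move=> sym skew u v w Pu Pv Pw; apply: smoothfun_addrr_eq0.
(* Three swaps of each kind, alternated, return to the same arguments with
   total sign -1. *)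
rewrite {2}sym // (skew v u w) // (sym v w u) // (skew w v u) // (sym w u v) //.
by rewrite (skew u w v) // opprK subrr.
Qed.

End VectorFields.

(** Module identities between vector fields become commutative ring identities
    once both sides are applied to a test function. *)
Ltac vfield_ring :=
  apply: vfield_der_inj => ?; rewrite !(derD, derN, derZ); ring.

(** * Almost contact pseudo-metric structures *)

Section AlmostContact.
Context {R : realType} {m : nat} {M : manifold R m}.
Context (A : almost_contact_pseudo_metric M).
Implicit Types (X Y Z W : vfield M).
Local Notation J := (phi A).
Local Notation g := (metric A).
Local Notation horizontal X := (eta A X = 0).

Lemma metric_xi X : g X (xi A) = eps A *: eta A X.
Proof.
have := metric_phi A X (xi A).
by rewrite phi_xi linear0 eta_xi mulr1 => /esym/subr0_eq.
Qed.

Lemma metric_phi_skew X Y : g (J X) Y = - g X (J Y).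
Proof.
have := metric_phi A X (J Y).
rewrite phi_sq eta_phi mulr0 scaler0 subr0 linearD linearN linearZ /=.
rewrite metric_xi eta_phi scaler0 /GRing.scale /= mulr0 addr0 => <-.
by rewrite opprK.
Qed.

Lemma phi_phi_eq0 W : J (J W) = 0 -> W = eta A W *: xi A.
Proof. by rewrite phi_sq addrC => /subr0_eq. Qed.

(** [xi] spans both the kernel of [phi] and the orthogonal complement of the
    horizontal fields.  For the second, [phi] is skew and takes horizontal values,
    so [phi W] pairs to zero with every field and nondegeneracy applies. *)
Lemma phi_eq0P W : J W = 0 <-> (forall Z, horizontal Z -> g W Z = 0).
Proof.
split=> [JW0 Z Z0|W0].
  have /phi_phi_eq0 -> : J (J W) = 0 by rewrite JW0 linear0.
  rewrite Defs.metric_sym linearZ /= metric_xi Z0 scaler0.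
  by rewrite /GRing.scale /= mulr0.
apply: vfield_ext => p; apply: (@metric_nondeg _ _ _ g) => Z.
by rewrite metric_phi_skew W0 ?eta_phi // oppr0.
Qed.

(** On fields killed by [theta] the exterior derivative only sees the bracket,
    and [J (J Y) = - Y], so Hermitian symmetry of the Levi form is the first half
    of integrability. *)
Lemma hermitian_lie_horizontal :
  levi_hermitian (ker_form (eta A)) J (\- eta A : form1 M) ->
  forall X Y, horizontal X -> horizontal Y ->
  horizontal (lie (J X) Y + lie X (J Y)).
Proof.
move=> herm X Y X0 Y0.
have JJY : J (J Y) = - Y by rewrite phi_sq Y0 scale0r addr0.
have dE (Z W : vfield M) : horizontal Z -> horizontal W ->
    dform (\- eta A : form1 M) Z W = 2^-1 *: eta A (lie Z W).
  by move=> Z0 W0; rewrite /dform /= Z0 W0 oppr0 !der0r subr0 sub0r opprK.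
have half0 : 2^-1 != 0 :> R by rewrite invr_eq0 pnatr_eq0.
have := herm X Y X0 Y0.
have NY0 : horizontal (- Y) by rewrite linearN /= Y0 oppr0.
rewrite /levi_form JJY !dE ?eta_phi // lieNr.
move/(@scalerI _ _ _ half0).
by rewrite linearD linearN /= => <-; rewrite subrr.
Qed.

Context (D : connection M) (D_levi_civita : levi_civita g D).

(** * The covariant derivative of the structure tensor *)

Lemma metric_cov_phi_skew X Y Z :
  g (cov_endo D X J Y) Z = - g Y (cov_endo D X J Z).
Proof.
have := D_levi_civita.2 X (J Y) Z.
rewrite metric_phi_skew derNr D_levi_civita.2 metric_phi_skew.
rewrite /cov_endo metricBl linearB /= metric_phi_skew.
by move/esym/eqP; rewrite subr_eq => /eqP ->; ring.
Qed.

(** Differentiating [J^2 = -1]; the term along [xi] appears because [nabla_X Y]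
    need not be horizontal when [Y] is. *)
Lemma cov_phi_phi X Y : horizontal Y ->
  cov_endo D X J (J Y) = - J (cov_endo D X J Y) - eta A (D X Y) *: xi A.
Proof.
move=> Y0; rewrite /cov_endo linearB /= !phi_sq Y0 scale0r addr0 nablaNr.
vfield_ring.
Qed.

Definition twist X Y := J (cov_endo D X J Y) - cov_endo D (J X) J Y.

(** [nabla_Z J] is skew by [metric_cov_phi_skew], and so is
    [J (nabla_Z J)]: it is a product of two skew maps that anticommute
    modulo [xi], and [xi] is orthogonal to the horizontal arguments. *)
Lemma metric_twist_skew X Y Z : horizontal Y -> horizontal Z ->
  g (twist X Y) Z = - g (twist X Z) Y.
Proof.
move=> Y0 Z0.
have JZ : g Y (cov_endo D X J (J Z)) = g (cov_endo D X J Z) (J Y).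
  rewrite cov_phi_phi // linearB linearZ /= metric_xi Y0 scaler0.
  rewrite /GRing.scale /= mulr0 subr0 linearN /= -metric_phi_skew.
  exact: Defs.metric_sym.
rewrite /twist !(metricBl _ (J _)) !metric_phi_skew.
rewrite (metric_cov_phi_skew _ Y) (metric_cov_phi_skew _ Y Z) JZ.
by rewrite !(Defs.metric_sym _ Y); ring.
Qed.

Definition commutator X Y := cov_endo D X J Y - cov_endo D (J X) J (J Y).

Lemma phi_commutator X Y : horizontal Y ->
  J (commutator X Y) = twist X Y + eta A (cov_endo D (J X) J Y) *: xi A.
Proof.
move=> Y0; rewrite /commutator linearB /= (cov_phi_phi _ _ Y0).
rewrite [J (- _ - _)]linearB linearN linearZ /= phi_xi phi_sq scaler0 subr0.
rewrite /twist; vfield_ring.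
Qed.

Lemma phi_phi_commutator X Y : horizontal Y ->
  J (J (commutator X Y)) = J (twist X Y).
Proof.
by move=> Y0; rewrite phi_commutator // linearD linearZ /= phi_xi scaler0 addr0.
Qed.

Lemma eta_commutator X Y : horizontal Y ->
  eta A (commutator X Y) =
  cov_form D X (\- eta A : form1 M) (J Y) +
  cov_form D (J X) (\- eta A : form1 M) Y.
Proof.
move=> Y0; rewrite /commutator /cov_endo !linearB /= !eta_phi phi_sq Y0.
rewrite scale0r addr0 nablaNr linearN /cov_form /= eta_phi Y0 oppr0 !der0r.
ring.
Qed.

(** * The integrability tensor *)

Definition nijenhuis X Y :=
  J (lie (J X) Y + lie X (J Y)) - (lie (J X) (J Y) - lie X Y).

Lemma nijenhuis_twist X Y : horizontal X -> horizontal Y ->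
  nijenhuis X Y = twist X Y - twist Y X + eta A (lie X Y) *: xi A.
Proof.
move=> X0 Y0; rewrite /nijenhuis -!D_levi_civita.1 /twist /cov_endo.
rewrite [J (_ + _)]linearD /= ![J (_ - _)]linearB /= !phi_sq.
vfield_ring.
Qed.

Lemma phi_nijenhuis X Y : horizontal X -> horizontal Y ->
  J (nijenhuis X Y) = J (twist X Y) - J (twist Y X).
Proof.
move=> X0 Y0; rewrite nijenhuis_twist // linearD linearB linearZ /=.
by rewrite phi_xi scaler0 addr0.
Qed.

Lemma CR_integrable_twistP :
  levi_hermitian (ker_form (eta A)) J (\- eta A : form1 M) ->
  CR_integrable (ker_form (eta A)) J <->
  (forall X Y, horizontal X -> horizontal Y -> J (twist X Y) = J (twist Y X)).
Proof.
move=> /hermitian_lie_horizontal lieH; split=> [int X Y X0 Y0|sym X Y X0 Y0].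
  apply: subr0_eq; rewrite -phi_nijenhuis // /nijenhuis.
  by have [_ ->] := int X Y X0 Y0; rewrite subrr linear0.
split; first exact: lieH.
have etaN : horizontal (nijenhuis X Y).
  (* The second argument [J Y] turns the first condition into
     [eta ([J X, J Y] - [X, Y]) = 0]. *)
  have := lieH X (J Y) X0 (eta_phi A Y).
  rewrite phi_sq Y0 scale0r addr0 lieNr => bracket0.
  by rewrite /nijenhuis linearB /= eta_phi bracket0 subr0.
apply: subr0_eq; rewrite -/(nijenhuis X Y).
have /phi_phi_eq0 -> : J (J (nijenhuis X Y)) = 0.
  by rewrite phi_nijenhuis // (sym X Y) // subrr linear0.
by rewrite etaN scale0r.
Qed.

(** Symmetry of [twist] is only known modulo [xi], which pairing with horizontal
    fields does not see; this is why the trilinear argument runs on them. *)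
Lemma twist_sym_eq0 :
  (forall X Y, horizontal X -> horizontal Y -> J (twist X Y) = J (twist Y X)) ->
  forall X Y, horizontal X -> horizontal Y -> J (twist X Y) = 0.
Proof.
move=> sym X Y X0 Y0; apply/phi_eq0P => Z Z0.
pose t X Y Z := g (twist X Y) Z.
apply: (@sym_skew_eq0 _ _ _ _ (fun X => horizontal X) t) => //
  {X0 Y0 Z0} {}X {}Y {}Z X0 Y0 Z0; last exact: metric_twist_skew.
apply: subr0_eq; rewrite /t -metricBl.
suff /phi_eq0P -> : J (twist X Y - twist Y X) = 0 by [].
by rewrite linearB /= sym // subrr.
Qed.

End AlmostContact.

Theorem theorem6p3 (R : realType) (n : nat) (M : manifold R n.*2.+1)
    (M_connected : connected [set: M])
    (A : almost_contact_pseudo_metric M)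
    (D : connection M) (D_levi_civita : levi_civita (metric A) D) :
  let H : set (vfield M) := ker_form (eta A) in
  let J : endo M := phi A in
  let theta : form1 M := \- eta A in
  let alpha (X Y : vfield M) : smoothfun M :=
    cov_form D X theta (J Y) + cov_form D (J X) theta Y in
  CR_nondegenerate H J theta ->
  (CR_integrable H J <->
   forall X Y : vfield M, H X -> H Y ->
     cov_endo D X J Y - cov_endo D (J X) J (J Y) = alpha X Y *: xi A).
Proof.
move=> H J theta alpha [herm _].
apply: (iff_trans (CR_integrable_twistP A D D_levi_civita herm)).
split=> [sym X Y X0 Y0|crit].
  rewrite /alpha -eta_commutator //; apply: phi_phi_eq0.
  rewrite -/(commutator A D X Y) phi_phi_commutator //.
  exact: (twist_sym_eq0 A D D_levi_civita sym).
have T0 X Y : H X -> H Y -> J (twist A D X Y) = 0.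
  move=> X0 Y0; rewrite -phi_phi_commutator // /commutator crit //.
  by rewrite linearZ /= phi_xi scaler0 linear0.
by move=> X Y X0 Y0; rewrite (T0 X Y X0 Y0) (T0 Y X Y0 X0).
Qed.
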